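(* Every partial 2-tree (equivalently, every graph of treewidth at most $2$) has a plane straight-line $\delta_2$-obstacle embedding.
   Context: Graphs are finite, simple and undirected. A 2-tree is a graph obtained from a triangle by repeatedly adding a new vertex adjacent to exactly the two endpoints of an existing edge; a partial 2-tree is a subgraph of a 2-tree. For $x\in\mathbb{R}^2$ and $i\in\{0,1,2,3\}$ let $Q^2_i(x)=x+\{r(\cos\theta,\sin\theta): r\ge 0,\ i\pi/2\le\theta\le (i+1)\pi/2\}$ be the $i$-th closed quadrant at $x$. A curve is a continuous map $f:[0,1]\to\mathbb{R}^2$; it is $\delta_2$-monotone if for some $i$ we have $f(b)\in Q^2_i(f(a))$ for all $0\le a\le b\le 1$ (these are the geodesics of the $L_1$ distance $\delta_2$). A plane $\delta_2$-obstacle embedding of $G$ is a pair $(\varphi,c)$, where $\varphi:V(G)\to\mathbb{R}^2$ is injective and $c$ assigns to each edge $uw$ a $\delta_2$-monotone curve with endpoints $\varphi(u),\varphi(w)$, such that the drawing is plane (edge curves are simple, contain no vertex points other than their endpoints, and two distinct edge curves meet only at a common endpoint), and such that whenever there is a path in $G$ with distinct end vertices $u,w$ whose edge curves concatenate to a $\delta_2$-monotone curve, then $uw\in E(G)$. It is straight-line if every $c(uw)$ is a line segment. *)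

(* Defs.v *)
From HB Require Import structures.
From mathcomp Require Import all_boot all_order all_algebra.
From mathcomp Require Import all_classical all_reals all_analysis.
Set Implicit Arguments.
Unset Strict Implicit.
Unset Printing Implicit Defensive.
Import Order.TTheory GRing.Theory Num.Theory.
Import numFieldNormedType.Exports.
Local Open Scope classical_set_scope.
Local Open Scope ring_scope.

Record sgraph := SGraph {
  vertex :> finType;
  edge : rel vertex;
  edge_sym : symmetric edge;
  edge_irrefl : irreflexive edge }.

Definition triangle_rel : rel 'I_3 := fun i j => i != j.

Lemma triangle_sym : symmetric triangle_rel.
Proof. by move=> i j; rewrite /triangle_rel eq_sym. Qed.

Lemma triangle_irrefl : irreflexive triangle_rel.
Proof. by move=> i; rewrite /triangle_rel eqxx. Qed.

Definition triangle : sgraph := SGraph triangle_sym triangle_irrefl.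

(* [None] is the new vertex; its neighbours are exactly [a] and [b]. *)
Definition stack_rel (G : sgraph) (a b : G) : rel (option G) :=
  fun x y => match x, y with
  | Some x, Some y => edge x y
  | Some x, None => (x == a) || (x == b)
  | None, Some y => (y == a) || (y == b)
  | None, None => false
  end.

Lemma stack_sym (G : sgraph) (a b : G) : symmetric (stack_rel a b).
Proof. by move=> [x|] [y|] //=; exact: edge_sym. Qed.

Lemma stack_irrefl (G : sgraph) (a b : G) : irreflexive (stack_rel a b).
Proof. by move=> [x|] //=; exact: edge_irrefl. Qed.

Definition stack (G : sgraph) (a b : G) : sgraph :=
  SGraph (stack_sym a b) (stack_irrefl a b).

Inductive two_tree : sgraph -> Prop :=
  | two_tree_triangle : two_tree triangle
  | two_tree_stack (G : sgraph) (a b : G) :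
      two_tree G -> edge a b -> two_tree (stack a b)
  | two_tree_iso (G H : sgraph) (f : G -> H) :
      bijective f -> {mono f : x y / edge x y} -> two_tree G -> two_tree H.

(* Subgraphs are taken up to isomorphism and need not be induced. *)
Definition subgraph (G H : sgraph) : Prop :=
  exists2 f : G -> H, injective f & {homo f : x y / edge x y}.

Definition partial_two_tree (G : sgraph) : Prop :=
  exists2 H : sgraph, two_tree H & subgraph G H.

Section Plane.
Variable R : realType.
Implicit Types (x y : R * R) (f g : R -> R * R).

Definition quadrant (i : 'I_4) x : set (R * R) :=
  [set y | exists r theta : R,
     [/\ 0 <= r, i%:R * (pi / 2) <= theta <= i.+1%:R * (pi / 2) &
         y = (x.1 + r * cos theta, x.2 + r * sin theta)]].

(* A curve is a total function on [R] of which only the values on [0, 1] are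
   relevant. *)
Definition curve f : Prop := {within `[0, 1], continuous f}.

Definition delta2_monotone f : Prop :=
  exists i : 'I_4, forall a b : R,
    0 <= a -> a <= b -> b <= 1 -> quadrant i (f a) (f b).

Definition concat f g : R -> R * R :=
  fun t => if t <= 2^-1 then f (2 * t) else g (2 * t - 1).

Definition segment x y : set (R * R) :=
  [set ((1 - t) * x.1 + t * y.1, (1 - t) * x.2 + t * y.2) | t in `[0, 1]].

Section Drawing.
Variables (G : sgraph) (phi : G -> R * R).
(* [c u w] is the curve of the edge [uw] traversed from [u] to [w]; the values
   of [c] at non-adjacent pairs are irrelevant. *)
Variable c : G -> G -> R -> R * R.

(* The concatenated edge curves along the nonempty walk [u :: w :: p]. *)
Fixpoint path_curve (u w : G) (p : seq G) : R -> R * R :=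
  if p is v :: p' then concat (c u w) (path_curve w v p') else c u w.

Record plane_drawing : Prop := PlaneDrawing {
  vertex_inj : injective phi;
  edge_curve : forall u w, edge u w -> curve (c u w);
  edge_source : forall u w, edge u w -> c u w 0 = phi u;
  edge_target : forall u w, edge u w -> c u w 1 = phi w;
  edge_reverse : forall u w, edge u w ->
    {in `[0, 1], forall t, c w u t = c u w (1 - t)};
  edge_simple : forall u w, edge u w -> {in `[0, 1] &, injective (c u w)};
  edge_avoids_vertices : forall u w v, edge u w ->
    {in `[0, 1], forall t, c u w t = phi v -> v = u \/ v = w};
  edges_noncrossing : forall u w u' w', edge u w -> edge u' w' ->
    [set u; w]%SET != [set u'; w']%SET ->
    {in `[0, 1] &, forall s t, c u w s = c u' w' t ->
       exists2 v, v \in [set u; w]%SET :&: [set u'; w']%SET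
                & c u w s = phi v} }.

(* [path edge u (w :: p)] with [uniq (u :: w :: p)] says that [u :: w :: p] is
   a path of [G]; its ends are [u] and [last w p], and they are distinct. *)
Record plane_delta2_obstacle_embedding : Prop := PlaneObstacleEmbedding {
  obstacle_plane : plane_drawing;
  obstacle_monotone : forall u w, edge u w -> delta2_monotone (c u w);
  obstacle_adjacent : forall (u w : G) (p : seq G),
    path (@edge G) u (w :: p) -> uniq (u :: w :: p) ->
    delta2_monotone (path_curve u w p) -> edge u (last w p) }.

Definition straight_line : Prop :=
  forall u w, edge u w -> c u w @` `[0, 1] = segment (phi u) (phi w).

End Drawing.
End Plane.

(* Main.v *)
Require Import Defs.
From mathcomp Require Import all_boot all_order all_algebra.
From mathcomp Require Import all_classical all_reals all_analysis.
From mathcomp Require Import ring lra.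
Set Implicit Arguments.
Unset Strict Implicit.
Unset Printing Implicit Defensive.
Import Order.TTheory GRing.Theory Num.Theory.
Import numFieldNormedType.Exports.
Local Open Scope ring_scope.

(* The 2-tree [H] containing [G] is drawn stacking by stacking.  Every edge of
   [H], present in [G] or not, is a side of a closed triangle, and distinct
   triangles meet only at common vertices; the vertex stacked on [ab] and the
   triangles of the new edges are placed inside the triangle of [ab], so the
   drawing stays plane.  A drawing without horizontal or vertical edges has no
   bad monotone path as soon as, for each open quadrant, the relation "[y] is a
   neighbour of [x] in this quadrant of [x]" is transitive.  To maintain this,
   every vertex has a set of allowed quadrants containing its neighbours, and
   each edge [ab] of [H] is kept in one of two states.  Either [ab] is in [G],
   [a] has no neighbour opposite to [b] and [b] none opposite to [a]: then the
   new vertex [v] goes between [a] and [b], where the monotone path [avb] is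
   harmless because [ab] is an edge.  Or the triangle is wide at [a]: then [v]
   is put close to [a] so that [av] and [bv] have slopes of opposite signs and
   continue no edge at [a] or [b]. *)

(** * Triangles, affine coordinates and separating lines *)

Lemma pair_ext (A B : Type) (z w : A * B) : z.1 = w.1 -> z.2 = w.2 -> z = w.
Proof. by case: z w => [? ?] [? ?] /= -> ->. Qed.

Section Triangles.
Variable F : realFieldType.
Implicit Types (p q r v z w : F * F) (l : F * F * F).

(** The weights [w] are themselves a point of the plane: [bary p q r] is the affine map taking the
    frame (0, 0), (1, 0), (0, 1) to [p], [q], [r]. Configurations are built in the frame and carried
    over. *)
Definition bary p q r w : F * F :=
  (p.1 + w.1 * (q.1 - p.1) + w.2 * (r.1 - p.1),
   p.2 + w.1 * (q.2 - p.2) + w.2 * (r.2 - p.2)).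

Definition tri p q r z : Prop :=
  exists w, [/\ 0 <= w.1, 0 <= w.2, w.1 + w.2 <= 1 & z = bary p q r w].

Definition det p q r : F :=
  (q.1 - p.1) * (r.2 - p.2) - (q.2 - p.2) * (r.1 - p.1).

Definition aff l z : F := l.1.1 + l.1.2 * z.1 + l.2 * z.2.

Lemma bary_comp p q r a b c w :
  bary p q r (bary a b c w) =
  bary (bary p q r a) (bary p q r b) (bary p q r c) w.
Proof. by apply: pair_ext => /=; ring. Qed.

Lemma bary00 p q r : bary p q r (0, 0) = p.
Proof. by apply: pair_ext => /=; ring. Qed.

Lemma bary10 p q r : bary p q r (1, 0) = q.
Proof. by apply: pair_ext => /=; ring. Qed.

Lemma bary01 p q r : bary p q r (0, 1) = r.
Proof. by apply: pair_ext => /=; ring. Qed.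

Lemma bary_inj p q r : det p q r != 0 -> injective (bary p q r).
Proof.
move=> D0 z w [e1 e2].
have d1 : (z.1 - w.1) * (q.1 - p.1) + (z.2 - w.2) * (r.1 - p.1) = 0 by lra.
have d2 : (z.1 - w.1) * (q.2 - p.2) + (z.2 - w.2) * (r.2 - p.2) = 0 by lra.
(* Cramer's rule: each unknown is eliminated in turn from [d1] and [d2]. *)
have c1 : det p q r * (z.1 - w.1) = 0.
  transitivity ((r.2 - p.2) * ((z.1 - w.1) * (q.1 - p.1) + (z.2 - w.2) * (r.1 - p.1))
   - (r.1 - p.1) * ((z.1 - w.1) * (q.2 - p.2) + (z.2 - w.2) * (r.2 - p.2))).
    by rewrite /det; ring.
  by rewrite d1 d2; ring.
have c2 : det p q r * (z.2 - w.2) = 0.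
  transitivity ((q.1 - p.1) * ((z.1 - w.1) * (q.2 - p.2) + (z.2 - w.2) * (r.2 - p.2))
   - (q.2 - p.2) * ((z.1 - w.1) * (q.1 - p.1) + (z.2 - w.2) * (r.1 - p.1))).
    by rewrite /det; ring.
  by rewrite d1 d2; ring.
move/eqP: c1; rewrite mulf_eq0 (negbTE D0) subr_eq0 /= => /eqP ?.
move/eqP: c2; rewrite mulf_eq0 (negbTE D0) subr_eq0 /= => /eqP ?.
exact: pair_ext.
Qed.

Lemma det_bary p q r a b c :
  det (bary p q r a) (bary p q r b) (bary p q r c) = det p q r * det a b c.
Proof. by rewrite /det /=; ring. Qed.

Lemma triA p q r : tri p q r p.
Proof. by exists (0, 0); rewrite /= addr0 ler01 lexx bary00. Qed.

Lemma triB p q r : tri p q r q.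
Proof. by exists (1, 0); rewrite /= addr0 ler01 !lexx bary10. Qed.

Lemma tri_swap p q r z : tri p q r z -> tri q p r z.
Proof.
move=> [w [w1 w2 w3 ->]]; exists (1 - w.1 - w.2, w.2) => /=.
by split=> //; [lra | lra | apply: pair_ext => /=; ring].
Qed.

Lemma aff_bary l p q r w :
  aff l (bary p q r w) =
  (1 - w.1 - w.2) * aff l p + w.1 * aff l q + w.2 * aff l r.
Proof. by rewrite /aff /=; ring. Qed.

Lemma aff_ge0 l p q r z :
  0 <= aff l p -> 0 <= aff l q -> 0 <= aff l r -> tri p q r z -> 0 <= aff l z.
Proof.
move=> hp hq hr [w [w1 w2 w3 ->]]; rewrite aff_bary.
by rewrite !addr_ge0 // mulr_ge0 //; lra.
Qed.

(* [aff l] vanishes at the common vertex and has opposite signs on the two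
   opposite sides. *)
Lemma tri_separated l p q r q' r' z :
  aff l p = 0 -> 0 < aff l q -> 0 < aff l r -> aff l q' < 0 -> aff l r' < 0 ->
  tri p q r z -> tri p q' r' z -> z = p.
Proof.
move=> hp hq hr hq' hr' [w [w1 w2 w3 ->]] [w' [w1' w2' w3' e]].
have := congr1 (aff l) e; rewrite !aff_bary hp !mulr0 !add0r => s.
have n1 : 0 <= w.1 * aff l q by rewrite mulr_ge0 // ltW.
have n2 : 0 <= w.2 * aff l r by rewrite mulr_ge0 // ltW.
have n3 : w'.1 * aff l q' <= 0 by rewrite mulr_ge0_le0 // ltW.
have n4 : w'.2 * aff l r' <= 0 by rewrite mulr_ge0_le0 // ltW.
have /eqP : w.1 * aff l q = 0 by lra.
have /eqP : w.2 * aff l r = 0 by lra.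
rewrite !mulf_eq0 (gt_eqF hq) (gt_eqF hr) !orbF => /eqP z2 /eqP z1.
by apply: pair_ext; rewrite /= z1 z2; ring.
Qed.

(** [v] is the stacked vertex; [s0], [s1], [s2] are the apexes of the triangles kept for the sides
    [pq], [pv], [qv]. *)
Record tri_split p q r v s0 s1 s2 : Prop := TriSplit {
  split_sub0 : forall z, tri p q s0 z -> tri p q r z;
  split_sub1 : forall z, tri p v s1 z -> tri p q r z;
  split_sub2 : forall z, tri q v s2 z -> tri p q r z;
  split_meet01 : forall z, tri p q s0 z -> tri p v s1 z -> z = p;
  split_meet02 : forall z, tri p q s0 z -> tri q v s2 z -> z = q;
  split_meet12 : forall z, tri p v s1 z -> tri q v s2 z -> z = v }.

Lemma tri_bary p q r a b c z :
  tri (bary p q r a) (bary p q r b) (bary p q r c) z ->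
  exists2 w, tri a b c w & z = bary p q r w.
Proof.
move=> [w [w1 w2 w3 ->]]; exists (bary a b c w); last by rewrite bary_comp.
by exists w.
Qed.

Lemma tri_split_bary p q r v s0 s1 s2 : det p q r != 0 ->
  tri_split (0, 0) (1, 0) (0, 1) v s0 s1 s2 ->
  tri_split p q r (bary p q r v) (bary p q r s0) (bary p q r s1) (bary p q r s2).
Proof.
move=> D0 [h0 h1 h2 m01 m02 m12].
have sub a b c : (forall z, tri a b c z -> tri (0, 0) (1, 0) (0, 1) z) ->
    forall z, tri (bary p q r a) (bary p q r b) (bary p q r c) z -> tri p q r z.
  move=> h z /tri_bary [w /h [w' [w1 w2 w3 ->]] ->]; exists w'; split=> //.
  by rewrite bary_comp bary00 bary10 bary01.
have meet a b c a' b' c' d :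
    (forall z, tri a b c z -> tri a' b' c' z -> z = d) ->
    forall z, tri (bary p q r a) (bary p q r b) (bary p q r c) z ->
      tri (bary p q r a') (bary p q r b') (bary p q r c') z -> z = bary p q r d.
  move=> h z /tri_bary [w t ->] /tri_bary [w' t' /(bary_inj D0) e].
  by rewrite (h w) // e.
split.
- by have := sub _ _ _ h0; rewrite bary00 bary10.
- by have := sub _ _ _ h1; rewrite bary00.
- by have := sub _ _ _ h2; rewrite bary10.
- by have := meet _ _ _ _ _ _ _ m01; rewrite bary00 bary10.
- by have := meet _ _ _ _ _ _ _ m02; rewrite bary00 bary10.
- by have := meet _ _ _ _ _ _ _ m12; rewrite bary00 bary10.
Qed.

Definition in_frame w := [/\ 0 <= w.1, 0 <= w.2 & w.1 + w.2 <= 1].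

Lemma frame_tri a b c z : in_frame a -> in_frame b -> in_frame c ->
  tri a b c z -> tri (0, 0) (1, 0) (0, 1) z.
Proof.
move=> [a1 a2 a3] [b1 b2 b3] [c1 c2 c3] t.
exists z; split.
- by rewrite -[z.1](_ : aff (0, 1, 0) z = _) ?(aff_ge0 _ _ _ t) // /aff /=; lra.
- by rewrite -[z.2](_ : aff (0, 0, 1) z = _) ?(aff_ge0 _ _ _ t) // /aff /=; lra.
- rewrite -subr_ge0 (_ : 1 - _ = aff (1, -1, -1) z) ?(aff_ge0 _ _ _ t) // /aff /=; lra.
- by apply: pair_ext => /=; ring.
Qed.

(** Meets several upper bounds on one parameter at once; a bound [e * x < y] enters the list as
    [x / y]. *)
Lemma small (s : seq F) : exists2 e, 0 < e & {in s, forall k, e * k < 1}.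
Proof.
exists (1 + \sum_(k <- s) `|k|)^-1 => [|k ks].
  by rewrite invr_gt0 ltr_pwDl // sumr_ge0.
have pos : 0 < 1 + \sum_(k <- s) `|k| by rewrite ltr_pwDl // sumr_ge0.
rewrite mulrC ltr_pdivrMr // mul1r (big_rem k) //=.
have : 0 <= \sum_(y <- rem k s) `|y| by rewrite sumr_ge0.
have := ler_norm k; lra.
Qed.

End Triangles.

(** * Explicit splittings of the standard triangle *)

Section Frames.
Variable F : realFieldType.
Implicit Types (p q r v z w : F * F) (l : F * F * F).

(** Each [lij] gives a line through the common vertex of triangles [i] and [j], positive at the
    other vertices of [i] and negative at those of [j]. *)
Lemma frame_splitI v s0 s1 s2 (l01 l02 l12 : F * F * F) :
  in_frame v -> in_frame s0 -> in_frame s1 -> in_frame s2 ->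
  [/\ aff l01 (0, 0) = 0, 0 < aff l01 (1, 0), 0 < aff l01 s0,
      aff l01 v < 0 & aff l01 s1 < 0] ->
  [/\ aff l02 (1, 0) = 0, 0 < aff l02 (0, 0), 0 < aff l02 s0,
      aff l02 v < 0 & aff l02 s2 < 0] ->
  [/\ aff l12 v = 0, 0 < aff l12 (0, 0), 0 < aff l12 s1,
      aff l12 (1, 0) < 0 & aff l12 s2 < 0] ->
  tri_split (0, 0) (1, 0) (0, 1) v s0 s1 s2.
Proof.
move=> fv f0 f1 f2 [a1 a2 a3 a4 a5] [b1 b2 b3 b4 b5] [c1 c2 c3 c4 c5].
have fp : @in_frame F (0, 0) by split=> /=; lra.
have fq : @in_frame F (1, 0) by split=> /=; lra.
split; try by move=> z; apply: frame_tri.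
- by move=> z; apply: tri_separated a1 a2 a3 a4 a5.
- by move=> z /tri_swap; apply: tri_separated b1 b2 b3 b4 b5.
- by move=> z /tri_swap h /tri_swap; apply: tri_separated c1 c2 c3 c4 c5 h.
Qed.

(* The frame is the triangle with vertices (0, 0), (1, 0), (0, 1); the two points
   [s1] and [s2] lie above [v], on the side of the apex. *)
Lemma frame_split_between (m y1 y2 : F) : 0 < m -> m < 8^-1 ->
  `|y1| < 8^-1 -> `|y2| < 8^-1 -> y1 < y2 ->
  tri_split (0, 0) (1, 0) (0, 1)
    (2^-1, m) (2^-1, m / 2) (2^-1 + y1, 2 * m) (2^-1 + y2, 2 * m).
Proof.
move=> m0 m8; rewrite !ltr_norml => /andP[a1 b1] /andP[a2 b2] y12.
have [c1 c2] : 0 < m * (8^-1 - y1) /\ 0 < m * (8^-1 + y1).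
  by split; apply: mulr_gt0; lra.
have [d1 d2] : 0 < m * (8^-1 - y2) /\ 0 < m * (8^-1 + y2).
  by split; apply: mulr_gt0; lra.
have e : 0 < m * (y2 - y1) by apply: mulr_gt0; lra.
(* From each corner the separating slope is 3m/2 in absolute value, between m toward [s0] and 2m
   toward [v]; [l12] joins [v] to the midpoint of [s1] and [s2]. *)
apply: (frame_splitI (l01 := (0, 3 / 2 * m, -1))
  (l02 := (3 / 2 * m, - (3 / 2 * m), -1))
  (l12 := (m / 2 - (y1 + y2) / 2 * m, - m, (y1 + y2) / 2))).
all: by rewrite /in_frame /aff; split=> /=; lra.
Qed.

(** For small [e], [v] is near (0, 0), in the direction (h, 1), which is almost that of the apex for
    small [h]. From [v], [s1] lies in the direction from (1, 0) to (0, 0), and [s2] in that from (0,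
    1) to (0, 0). *)
Lemma frame_split_corner (e h : F) : 0 < e -> 0 < h -> e < 4^-1 -> e * h < 4^-1 ->
  tri_split (0, 0) (1, 0) (0, 1)
    (e * h, e) (e * h, e / 8) (0, e) (e * h, e / 2).
Proof.
move=> e0 h0 e4 eh4.
have eh0 : 0 < e * h by apply: mulr_gt0.
have eeh0 : 0 < e * (e * h) by apply: mulr_gt0.
have eeh : 0 < e * (4^-1 - e * h) by apply: mulr_gt0; lra.
apply: (frame_splitI (l01 := (0, 1, -(5 * h)))
  (l02 := (3 / 8 * e, - (3 / 8 * e), -1))
  (l12 := (e * h - h / 2 * e, - 1, h / 2))).
all: by rewrite /in_frame /aff; split=> /=; lra.
Qed.

(** Same [v] and [s0], but [s1] and [s2] are on the reversed sides of [v]. The dip [m] puts [s1]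
    below the line from [v] to (1, 0), so that its triangle avoids that of the side from (1, 0) to
    [v]. *)
Lemma frame_split_corner' (e h m : F) : 0 < e -> 0 < h -> 0 < m -> m < 2^-1 ->
  e < 8^-1 -> e * h < 8^-1 -> e * (4 * h) < m ->
  tri_split (0, 0) (1, 0) (0, 1)
    (e * h, e) (e * h, e / 8) (e * (2 * h), e * (1 - m)) (e * h, 2 * e).
Proof.
move=> e0 h0 m0 m2 e8 eh8 ehm.
have eh0 : 0 < e * h by apply: mulr_gt0.
have eeh0 : 0 < e * (e * h) by apply: mulr_gt0.
have eeh : 0 < e * (8^-1 - e * h) by apply: mulr_gt0; lra.
have meh0 : 0 < m * (e * h) by apply: mulr_gt0.
have em : 0 < e * (2^-1 - m) by apply: mulr_gt0; lra.
have em' : 0 < e * m by apply: mulr_gt0; lra.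
have hm : 0 < h * (2^-1 - m) by apply: mulr_gt0; lra.
have ehm2 : 0 < e * h * (2^-1 - m) by apply: mulr_gt0; lra.
have mh : 0 < m * (8^-1 - e * h) by apply: mulr_gt0; lra.
apply: (frame_splitI (l01 := (0, 1, -(5 * h)))
  (l02 := (3 / 8 * e, - (3 / 8 * e), -1))
  (l12 := (2 * h * e + m * (e * h), - m, - (2 * h)))).
all: by rewrite /in_frame /aff; split=> /=; lra.
Qed.

End Frames.

(** * Open quadrants and the placement of a stacked vertex *)

(* An open quadrant; each flag tells whether the coordinate is negative. *)
Definition quad : Type := (bool * bool)%type.
Definition opquad (Q : quad) : quad := (~~ Q.1, ~~ Q.2).
Definition slope (Q : quad) : bool := Q.1 (+) Q.2.

Lemma opquadK : involutive opquad.
Proof. by move=> [[] []]. Qed.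

Section Quadrants.
Variable F : realFieldType.
Implicit Types (p q r v z w : F * F) (l : F * F * F).

Definition inq (Q : quad) p z : Prop :=
  0 < (-1) ^+ Q.1 * (z.1 - p.1) /\ 0 < (-1) ^+ Q.2 * (z.2 - p.2).

Lemma sgN (b : bool) : (-1) ^+ (~~ b) = - (-1) ^+ b :> F.
Proof. by case: b; rewrite /= ?expr0 ?expr1 ?opprK. Qed.

Lemma inqC Q p z : inq (opquad Q) z p <-> inq Q p z.
Proof. by rewrite /inq /= !sgN !mulNr -!mulrN !opprB. Qed.

Lemma inq_uniq Q P p z : inq Q p z -> inq P p z -> Q = P.
Proof.
by case: Q P => [[] []] [[] []] //; rewrite /inq /= ?expr0 ?expr1;
  move=> [? ?] [? ?]; exfalso; lra.
Qed.

Lemma inq_trans Q p z w : inq Q p z -> inq Q z w -> inq Q p w.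
Proof.
by case: Q => [[] []]; rewrite /inq /= ?expr0 ?expr1 => -[? ?] [? ?]; split; lra.
Qed.

Lemma inq_irrefl Q p : ~ inq Q p p.
Proof. by rewrite /inq subrr mulr0 ltxx => -[]. Qed.

Lemma inq_bary Q p q r w w' :
  inq Q (bary p q r w) (bary p q r w') <->
  0 < (w'.1 - w.1) * ((-1) ^+ Q.1 * (q.1 - p.1))
      + (w'.2 - w.2) * ((-1) ^+ Q.1 * (r.1 - p.1)) /\
  0 < (w'.1 - w.1) * ((-1) ^+ Q.2 * (q.2 - p.2))
      + (w'.2 - w.2) * ((-1) ^+ Q.2 * (r.2 - p.2)).
Proof.
have E (s w1 w2 w1' w2' x y t : F) :
  s * (x + w1' * y + w2' * t - (x + w1 * y + w2 * t)) =
  (w1' - w1) * (s * y) + (w2' - w2) * (s * t) by ring.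
by rewrite /inq /= !E.
Qed.

(** The conditions ask for points strictly between [- d / b] and [- c / a], an interval of length
    (ad - bc)/(ab); the two points chosen cut it into thirds. *)
Lemma interval_choice (a b c d : F) : 0 < a -> 0 < b -> 0 < a * d - b * c ->
  exists x1 x2, [/\ x1 < x2, c + x1 * a < 0, c + x2 * a < 0,
    0 < d + x1 * b & 0 < d + x2 * b].
Proof.
move=> a0 b0 D0.
have ab0 : 0 < a * b by apply: mulr_gt0.
set k := (a * d - b * c) / (3 * (a * b)).
have k0 : 0 < k by rewrite divr_gt0 // mulr_gt0.
have e1 (t : F) : c + (- c / a - t * k) * a = - t * (k * a).
  by rewrite mulrBl divfK ?gt_eqF //; ring.
have e2 (t : F) : d + (- c / a - t * k) * b = (3 - t) * (k * b).
  by rewrite /k; field; rewrite !gt_eqF.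
have ka : 0 < k * a by rewrite mulr_gt0.
have kb : 0 < k * b by rewrite mulr_gt0.
exists (- c / a - 2 * k), (- c / a - 1 * k).
by rewrite !e1 !e2; split; lra.
Qed.

Lemma ltr_scaled (m x y : F) : 0 < y -> m * (x / y) < 1 -> m * x < y.
Proof. by move=> y0; rewrite mulrA ltr_pdivrMr // mul1r. Qed.

(** The half-plane of [pq] containing [r] contains all directions of a quadrant [S] adjacent to [Q].
    A shift [x] along [pq] turns [r - p] into such a direction; two shifts give [s1] and [s2], and
    [v] is close to the middle of [pq]. *)
Lemma split_between Q p q r : det p q r != 0 -> inq Q p q ->
  exists v s0 s1 s2, exists S : quad,
    [/\ tri_split p q r v s0 s1 s2, det p q s0 != 0, inq Q p v & inq Q v q] /\
    [/\ slope S != slope Q, inq S v s1 & inq S v s2].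
Proof.
move=> D0 [a0 b0].
set a := (-1) ^+ Q.1 * _ in a0; set b := (-1) ^+ Q.2 * _ in b0.
pose c := (-1) ^+ Q.1 * (r.1 - p.1); pose d := (-1) ^+ Q.2 * (r.2 - p.2).
have D1 : a * d - b * c != 0.
  rewrite (_ : _ - _ = (-1) ^+ Q.1 * (-1) ^+ Q.2 * det p q r).
    by rewrite !mulf_neq0 ?signr_eq0.
  by rewrite /a /b /c /d /det; ring.
have [S [x1 [x2 [SQ x12 hx]]]] : exists S : quad, exists x1 x2 : F,
  [/\ slope S != slope Q, x1 < x2 & forall x (w : F * F) m, 0 < m -> x \in [:: x1; x2] ->
   inq S (bary p q r w) (bary p q r (w.1 + m * x, w.2 + m))].
  (* The orientation tells which of the two quadrants adjacent to [Q] is on the side of [r]. *)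
  have [D2|D2] : 0 < a * d - b * c \/ 0 < b * c - a * d.
    by move: D1; rewrite neq_lt => /orP[] ?; [right; lra | left].
  - have [x1 [x2 [x12 c1 c2 d1 d2]]] := interval_choice a0 b0 D2.
    exists (~~ Q.1, Q.2), x1, x2; split=> //;
      first by rewrite /slope /=; case: (Q.1); case: (Q.2).
    move=> x w m m0; rewrite !inE => xE; apply/inq_bary => /=.
    rewrite sgN !mulNr !mulrN -/a -/b -/c -/d.
    split.
      rewrite [ltRHS](_ : _ = m * - (c + x * a)); last by ring.
      by apply: mulr_gt0 => //; case/orP: xE => /eqP ->; lra.
    rewrite [ltRHS](_ : _ = m * (d + x * b)); last by ring.
    by apply: mulr_gt0 => //; case/orP: xE => /eqP ->; lra.
  - have [x1 [x2 [x12 c1 c2 d1 d2]]] := interval_choice b0 a0 D2.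
    exists (Q.1, ~~ Q.2), x1, x2; split=> //;
      first by rewrite /slope /=; case: (Q.1); case: (Q.2).
    move=> x w m m0; rewrite !inE => xE; apply/inq_bary => /=.
    rewrite sgN !mulNr !mulrN -/a -/b -/c -/d.
    split.
      rewrite [ltRHS](_ : _ = m * (c + x * a)); last by ring.
      by apply: mulr_gt0 => //; case/orP: xE => /eqP ->; lra.
    rewrite [ltRHS](_ : _ = m * - (d + x * b)); last by ring.
    by apply: mulr_gt0 => //; case/orP: xE => /eqP ->; lra.
have [m m0 hm] := small [:: 8; 8 * `|x1|; 8 * `|x2|; 2 * `|c| / a; 2 * `|d| / b].
have m8 : m * 8 < 1 by apply: hm; rewrite !inE eqxx.
have mx1 : m * (8 * `|x1|) < 1 by apply: hm; rewrite !inE eqxx ?orbT.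
have mx2 : m * (8 * `|x2|) < 1 by apply: hm; rewrite !inE eqxx ?orbT.
have mc : m * (2 * `|c|) < a.
  by apply: ltr_scaled => //; rewrite hm // !inE eqxx ?orbT.
have md : m * (2 * `|d|) < b.
  by apply: ltr_scaled => //; rewrite hm // !inE eqxx ?orbT.
have mabs x : `|m * x| = m * `|x| by rewrite normrM gtr0_norm.
have := frame_split_between m0 (y1 := m * x1) (y2 := m * x2).
rewrite !mabs ltr_pM2l // => /(_ _ _ _ x12) h.
have {h}/(tri_split_bary D0) h := h ltac:(lra) ltac:(lra) ltac:(lra).
exists (bary p q r (2^-1, m)), (bary p q r (2^-1, m / 2)).
exists (bary p q r (2^-1 + m * x1, 2 * m)), (bary p q r (2^-1 + m * x2, 2 * m)).
exists S.
have [/andP[mc1 mc2] /andP[md1 md2]] :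
  (- (a / 2) < m * c < a / 2) /\ (- (b / 2) < m * d < b / 2).
  by rewrite -!ltr_norml !mabs; split; lra.
split; split=> //.
- rewrite -{1}(bary00 p q r) -{2}(bary10 p q r) det_bary mulf_neq0 // /det /=.
  by rewrite gt_eqF //; lra.
- rewrite -{1}(bary00 p q r); apply/inq_bary => /=; rewrite -/a -/b -/c -/d.
  by split; lra.
- rewrite -{2}(bary10 p q r); apply/inq_bary => /=; rewrite -/a -/b -/c -/d.
  by split; lra.
- have := hx x1 (2^-1, m) m m0; rewrite !inE eqxx => /(_ isT) /=.
  by rewrite (_ : m + m = 2 * m) //; ring.
- have := hx x2 (2^-1, m) m m0; rewrite !inE eqxx orbT => /(_ isT) /=.
  by rewrite (_ : m + m = 2 * m) //; ring.
Qed.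

(** The order of choice matters: first the tilt [h], then the dip [m] depending on [h], then the
    scale [e] depending on both. *)
Lemma corner_choice (a b c d : F) : 0 < a -> 0 < b -> 0 < c -> 0 < d ->
  exists e h m, [/\ 0 < e, 0 < h, 0 < m & m < 2^-1] /\
   [/\ e < 8^-1, e * h < 8^-1 & e * (4 * h) < m] /\
   [/\ 8 * (h * b) < d, e * (h * a + c) < a & m * c < h * a].
Proof.
move=> a0 b0 c0 d0.
have [h h0 hh] := small [:: 8 * b / d].
have hb : h * (8 * b) < d by rewrite ltr_scaled // hh ?inE.
have [m m0 hm] := small [:: 2; c / (h * a)].
have m2 : m * 2 < 1 by rewrite hm // !inE eqxx ?orbT.
have ha : 0 < h * a by rewrite mulr_gt0.
have mc : m * c < h * a by rewrite ltr_scaled // hm // !inE eqxx ?orbT.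
have [e e0 he] := small [:: 8; 8 * h; 4 * h / m; (h * a + c) / a].
have e8 : e * 8 < 1 by rewrite he // !inE eqxx ?orbT.
have e8h : e * (8 * h) < 1 by rewrite he // !inE eqxx ?orbT.
have eh : e * (4 * h) < m by rewrite ltr_scaled // he // !inE eqxx ?orbT.
have ea : e * (h * a + c) < a by rewrite ltr_scaled // he // !inE eqxx ?orbT.
exists e, h, m; split; first by split=> //; lra.
by split; split=> //; lra.
Qed.

(** Signs of the displacements of [split_corner] in coordinates where [Q] is the positive quadrant,
    [q - p] is [(a, - b)] and [r - p] is [(c, d)]. *)
Lemma corner_facts (a b c d : F) : 0 < a -> 0 < b -> 0 < c -> 0 < d ->
  exists e h m, [/\ 0 < e, 0 < h, 0 < m & m < 2^-1] /\
   [/\ e < 8^-1, e * h < 8^-1 & e * (4 * h) < m] /\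
   [/\ 0 < e * h * a + e * c, 0 < e * h * (- b) + e * d,
       0 < e * h * a + e / 8 * c & 0 < e * h * (- b) + e / 8 * d] /\
   [/\ 0 < - ((e * h - 1) * a + e * c), 0 < (e * h - 1) * (- b) + e * d,
       0 < e * h * a & 0 < e * h * b] /\ (0 < e * c /\ 0 < e * d) /\
   (0 < e * h * a - e * m * c /\ 0 < e * h * b + e * m * d).
Proof.
move=> a0 b0 c0 d0.
have [e [h [m [[e0 h0 m0 m2] [[e8 eh8 ehm] [k1 k2 k3]]]]]] :=
  corner_choice a0 b0 c0 d0.
have eh0 : 0 < e * h by apply: mulr_gt0.
have eha : 0 < e * h * a by apply: mulr_gt0.
have ehb : 0 < e * h * b by apply: mulr_gt0.
have em : 0 < e * m by apply: mulr_gt0.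
have emd : 0 < e * m * d by apply: mulr_gt0.
have ec : 0 < e * c by apply: mulr_gt0.
have ed : 0 < e * d by apply: mulr_gt0.
have eb : 0 < (1 - e * h) * b by apply: mulr_gt0; lra.
have ek1 : 0 < e * (d - 8 * (h * b)) by apply: mulr_gt0; lra.
have ek3 : 0 < e * (h * a - m * c) by apply: mulr_gt0; lra.
by exists e, h, m; do 5 (split; first by split=> //; lra); split; lra.
Qed.

(** [v] is placed near [p], almost toward [r]. The first variant serves when [qv] is not drawn. The
    second serves when it is: [v] must then allow [opquad P], the quadrant of [q], so a hinge of
    [pv] at [v] can no longer use [P]. *)
Lemma split_corner Q P p q r : inq Q p r -> inq P q p -> slope P != slope Q ->
  exists v s0, [/\ inq Q p v, inq P q v & inq Q p s0] /\
   (exists s1 s2, [/\ tri_split p q r v s0 s1 s2,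
      inq P v s1 & inq (opquad Q) v s2] /\ (det p v s1 != 0 /\ det q v s2 != 0)) /\
   (exists s1 s2, [/\ tri_split p q r v s0 s1 s2,
      inq (opquad P) v s1 & inq Q v s2] /\ (det p v s1 != 0 /\ det q v s2 != 0)).
Proof.
move=> [c0 d0] /inqC [a0 b0] PQ.
move: a0 b0 c0 d0; rewrite /opquad /= !sgN.
set c := (-1) ^+ Q.1 * (r.1 - p.1); set d := (-1) ^+ Q.2 * (r.2 - p.2).
move=> a0 b0 c0 d0.
pose a := (-1) ^+ Q.1 * (q.1 - p.1); pose b := (-1) ^+ Q.2 * (q.2 - p.2).
have D0 : a * d - b * c != 0 -> det p q r != 0.
  rewrite (_ : _ - _ = (-1) ^+ Q.1 * (-1) ^+ Q.2 * det p q r).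
    by rewrite !mulf_eq0 !negb_or => /andP[].
  by rewrite /a /b /c /d /det; ring.
pose a' := (-1) ^+ P.1 * (q.1 - p.1); pose b' := (-1) ^+ P.2 * (q.2 - p.2).
pose c' := (-1) ^+ P.1 * (r.1 - p.1); pose d' := (-1) ^+ P.2 * (r.2 - p.2).
(* Opposite slopes mean that [P] and [Q] differ in exactly one coordinate; the two cases correspond
   under exchange of the coordinates. *)
have signs : [/\ a' = - a, b' = b, c' = - c & d' = d] /\ (0 < a /\ 0 < - b) \/
    [/\ a' = a, b' = - b, c' = c & d' = - d] /\ (0 < b /\ 0 < - a).
  rewrite /a' /b' /c' /d' /a /b /c /d.
  case: (P) (Q) PQ a0 b0 => [[] []] [[] []] //= _; rewrite ?expr0 ?expr1 => a0 b0;
    [right|left|right|left|left|right|left|right];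
    by split; split => //; lra.
(* [a * d] and [b * c] have opposite signs, which makes the triangle nondegenerate. *)
have {signs}[D1 [e [h [m [[e0 h0 m0 m2] [[e8 eh8 ehm] [[A1 A2 A3 A4]
    [[B1 B2 B3 B4] [[C1 C2] [E1 E2]]]]]]]]]] : a * d - b * c != 0 /\
  exists e h m, [/\ 0 < e, 0 < h, 0 < m & m < 2^-1] /\
   [/\ e < 8^-1, e * h < 8^-1 & e * (4 * h) < m] /\
   [/\ 0 < e * h * a + e * c, 0 < e * h * b + e * d,
       0 < e * h * a + e / 8 * c & 0 < e * h * b + e / 8 * d] /\
   [/\ 0 < (e * h - 1) * a' + e * c', 0 < (e * h - 1) * b' + e * d',
       0 < - (e * h * a') & 0 < - (e * h * b')] /\ (0 < e * c /\ 0 < e * d) /\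
   (0 < - (e * h * a' - e * m * c') /\ 0 < - (e * h * b' - e * m * d')).
  case: signs => -[[-> -> -> ->] [{}a0 {}b0]].
  - have ad : 0 < a * d by apply: mulr_gt0.
    have bc : 0 < - b * c by apply: mulr_gt0.
    split; first by rewrite gt_eqF //; lra.
    have [e [h [m [k1 [k2 [[A1 A2 A3 A4] [[B1 B2 B3 B4] [[C1 C2] [E1 E2]]]]]]]]] :=
      corner_facts a0 b0 c0 d0.
    exists e, h, m; rewrite opprK in A2 A4 B2.
    by do 3 (split; first by []); do 2 (split; first by split; lra); split; lra.
  - have ad : 0 < - a * d by apply: mulr_gt0.
    have bc : 0 < b * c by apply: mulr_gt0.
    split; first by rewrite lt_eqF //; lra.
    have [e [h [m [k1 [k2 [[A1 A2 A3 A4] [[B1 B2 B3 B4] [[C1 C2] [E1 E2]]]]]]]]] :=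
      corner_facts a0 b0 d0 c0.
    exists e, h, m; rewrite opprK in A2 A4 B2.
    by do 2 (split; first by []); do 3 (split; first by split; lra); split; lra.
have {D1}D0 := D0 D1.
have eh0 : 0 < e * h by apply: mulr_gt0.
have e2h0 : 0 < e * (e * h) by apply: mulr_gt0.
have em0 : 0 < e * m by apply: mulr_gt0.
have me2h0 : 0 < e * m * (e * h) by apply: mulr_gt0.
have eeh0 : 0 < e * (1 - e * h) by apply: mulr_gt0; lra.
have ee2h0 : 0 < e * (e * h) * (1 - m) by apply: mulr_gt0; lra.
exists (bary p q r (e * h, e)), (bary p q r (e * h, e / 8)); split.
  split.
  - rewrite -{1}(bary00 p q r); apply/inq_bary => /=; rewrite -/a -/b -/c -/d.
    by split; lra.
  - rewrite -{1}(bary10 p q r); apply/inq_bary => /=; rewrite -/a' -/b' -/c' -/d'.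
    by split; lra.
  - rewrite -{1}(bary00 p q r); apply/inq_bary => /=; rewrite -/a -/b -/c -/d.
    by split; lra.
have detp z w : det p (bary p q r z) (bary p q r w) = det p q r * det (0, 0) z w.
  by rewrite -{1}(bary00 p q r) det_bary.
have detq z w : det q (bary p q r z) (bary p q r w) = det p q r * det (1, 0) z w.
  by rewrite -{1}(bary10 p q r) det_bary.
split.
  exists (bary p q r (0, e)), (bary p q r (e * h, e / 2)); split.
    split.
    - by apply: tri_split_bary => //; apply: frame_split_corner => //; lra.
    - by apply/inq_bary => /=; rewrite -/a' -/b' -/c' -/d'; split; lra.
    - apply/inq_bary => /=; rewrite !sgN !mulNr -/a -/b -/c -/d.
      by split; lra.
  rewrite detp detq !mulf_neq0 //.
    by rewrite /det /= gt_eqF //; lra.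
  by rewrite /det /= gt_eqF //; lra.
exists (bary p q r (e * (2 * h), e * (1 - m))), (bary p q r (e * h, 2 * e)); split.
  split.
  - by apply: tri_split_bary => //; apply: frame_split_corner' => //; lra.
  - apply/inq_bary => /=; rewrite !sgN !mulNr -/a' -/b' -/c' -/d'.
    by split; lra.
  - by apply/inq_bary => /=; rewrite -/a -/b -/c -/d; split; lra.
rewrite detp detq !mulf_neq0 //.
  by rewrite /det /= lt_eqF //; lra.
by rewrite /det /= lt_eqF //; lra.
Qed.

End Quadrants.

(** * Layouts and their extension by one vertex *)

Section Layouts.
Variable F : realFieldType.

(* [E] is the edge relation of the 2-tree and [g] that of the graph to draw;
   [apex x y] is the third vertex of the triangle on the side [xy], and [al x]
   is the set of quadrants of [x] where neighbours are allowed. *)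
Section LayoutDef.
Variables (V : finType) (E g : rel V) (phi : V -> F * F) (apex : V -> V -> F * F).
Variable al : V -> quad -> bool.

Definition cell x y := tri (phi x) (phi y) (apex x y).

(** No allowed quadrant continues [xy] beyond either end, so a vertex can be put between [x] and
    [y]; nondegeneracy leaves room for its triangles. *)
Definition monotone_pair x y : Prop := exists Q : quad,
  [/\ g x y, inq Q (phi x) (phi y), ~~ al x (opquad Q), ~~ al y Q
    & det (phi x) (phi y) (apex x y) != 0].

(* The triangle of [xy] is wide at [x]: it contains points of the quadrant [Q]
   of [x] that are arbitrarily close to [x].  Such points are still in the
   quadrant [P] of [y], whose slope is opposite to that of [Q]. *)
Definition hinged_pair x y : Prop := exists Q P : quad,
  [/\ inq Q (phi x) (apex x y), inq P (phi y) (phi x) & slope P != slope Q] /\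
  [/\ al x Q, ~~ al x (opquad Q), al y P & ~~ al y (opquad P)].

Definition ready x y : Prop := monotone_pair x y \/ hinged_pair x y.

(** [layout_trans] speaks of two consecutive edges only; induction along a monotone path extends it
    to the obstacle condition. *)
Record layout : Prop := Layout {
  layout_inj : injective phi;
  layout_apexC : forall x y, apex x y = apex y x;
  layout_avoid : forall x y w, E x y -> cell x y (phi w) -> w = x \/ w = y;
  layout_meet : forall x y x' y' z, E x y -> E x' y' ->
    cell x y z -> cell x' y' z ->
    [set x; y] = [set x'; y'] \/
    exists2 v, v \in [set x; y] :&: [set x'; y'] & z = phi v;
  layout_al : forall x y, g x y -> exists2 Q, inq Q (phi x) (phi y) & al x Q;
  layout_trans : forall Q x y z, g x y -> g y z ->
    inq Q (phi x) (phi y) -> inq Q (phi y) (phi z) -> g x z;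
  layout_ready : forall x y, E x y -> ready x y \/ ready y x }.

End LayoutDef.

(** Serves to rename vertices and to pass to a subgraph of the 2-tree. The drawn relation must be
    the full pullback, since [layout_trans] is not inherited by subrelations. *)
Lemma layout_pull (V W : finType) (E g : rel V) (E' g' : rel W) (h : W -> V)
    phi apex al : injective h ->
  {homo h : x y / E' x y >-> E x y} -> (forall x y, g' x y = g (h x) (h y)) ->
  layout E g phi apex al ->
  layout E' g' (phi \o h) (fun x y => apex (h x) (h y)) (al \o h).
Proof.
move=> hinj hE hg [L1 L2 L3 L4 L5 L6 L7]; split=> /=.
- by move=> x y /L1 /hinj.
- by move=> x y; rewrite L2.
- by move=> x y w /hE xy /(L3 _ _ _ xy) [] /hinj ->; [left | right].
- move=> x y x' y' z /hE xy /hE xy' c c'.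
  have im u w : h @: [set u; w] = [set h u; h w] by rewrite imsetU1 imset_set1.
  case: (L4 _ _ _ _ _ xy xy' c c') => [|[v]].
    by rewrite -!im => /(imset_inj hinj); left.
  rewrite -!im inE => /andP[/imsetP[u uxy ->]].
  by rewrite (mem_imset _ _ hinj) => uxy' ->; right; exists u; rewrite // inE uxy.
- by move=> x y; rewrite hg => /L5.
- by move=> Q x y z; rewrite !hg; apply: L6.
- move=> x y /hE /L7.
  have R u w : ready g phi apex al (h u) (h w) ->
     ready g' (phi \o h) (fun x y => apex (h x) (h y)) (al \o h) u w.
    by rewrite /ready /monotone_pair hg.
  by move=> [] /R; [left | right].
Qed.

(* Subgraphs of a drawable graph need not be drawable, so the induction on
   2-trees quantifies over the subgraph. *)
Definition layable (G : sgraph) : Prop :=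
  forall g : rel G, symmetric g -> subrel g (@edge G) ->
  exists phi apex al, layout (@edge G) g phi apex al.

Section Extension.
Variables (G : sgraph) (a b : G) (g' : rel (option G)).
Hypotheses (g'C : symmetric g') (g'E : subrel g' (stack_rel a b)).
Variables (phi : G -> F * F) (apex : G -> G -> F * F) (al : G -> quad -> bool).
Let g : rel G := relpre Some g'.
Hypothesis L : layout (@edge G) g phi apex al.
Variables (v s0 s1 s2 : F * F) (alv : quad -> bool) (Qa Qb : quad).

Definition ext_phi (x : option G) : F * F := if x is Some x then phi x else v.

(** The triangle of [ab] shrinks to the apex [s0]; the value at [None, None] is a default, as this
    pair is not an edge. *)
Definition ext_apex (x y : option G) : F * F :=
  match x, y with
  | Some x, Some y =>
      if (x == a) && (y == b) || (x == b) && (y == a) then s0 else apex x y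
  | Some x, None | None, Some x => if x == a then s1 else s2
  | None, None => v
  end.

Definition ext_al (x : option G) : quad -> bool :=
  if x is Some x then al x else alv.

Hypotheses (ab : edge a b).
Hypothesis split_ab : tri_split (phi a) (phi b) (apex a b) v s0 s1 s2.
Hypotheses (va : inq Qa (phi a) v) (vb : inq Qb (phi b) v).
(** With the quadrants opposite to [v] closed at [a] and [b], no monotone path passes through [a] or
    [b] to [v]; [Qab] covers the remaining new path, [avb]. *)
Hypotheses (ala : ~~ al a (opquad Qa)) (alb : ~~ al b (opquad Qb)).
Hypothesis Qab : Qa = opquad Qb -> g a b.
Hypothesis real_va : g' None (Some a) -> al a Qa /\ alv (opquad Qa).
Hypothesis real_vb : g' None (Some b) -> al b Qb /\ alv (opquad Qb).

Let ready' := ready g' ext_phi ext_apex ext_al.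
Hypothesis ready_ab : ready' (Some a) (Some b).
Hypothesis ready_av : ready' (Some a) None \/ ready' None (Some a).
Hypothesis ready_bv : ready' (Some b) None \/ ready' None (Some b).

Let ab_neq : b == a = false.
Proof. by apply/negP => /eqP ba; move: ab; rewrite ba edge_irrefl. Qed.

Let apexC := layout_apexC L.

Let ext_apexC x y : ext_apex x y = ext_apex y x.
Proof.
case: x y => [x|] [y|] //=; rewrite apexC.
by rewrite [X in _ || X]andbC [X in X || _]andbC orbC.
Qed.

(** Passing to unordered pairs removes the orientations: a cell is an untouched old one or one of
    the three parts cut from the cell of [ab]. *)
Lemma ext_cellP x y z : stack_rel a b x y -> cell ext_phi ext_apex x y z ->
  [\/ exists x0 y0, [/\ x = Some x0, y = Some y0, edge x0 y0,
          [set x0; y0] <> [set a; b] & cell phi apex x0 y0 z],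
      [set x; y] = [set Some a; Some b] /\ tri (phi a) (phi b) s0 z,
      [set x; y] = [set Some a; None] /\ tri (phi a) v s1 z |
      [set x; y] = [set Some b; None] /\ tri (phi b) v s2 z].
Proof.
case: x y => [x|] [y|] //=; rewrite /cell /=.
- case: ifP => [/orP[] /andP[/eqP-> /eqP->] _|N xy].
  + by constructor 2.
  + by move/tri_swap; constructor 2; rewrite finset.setUC.
  + move=> c; constructor 1; exists x, y; split=> // e.
    have : x \in [set a; b] by rewrite -e !inE eqxx.
    have : y \in [set a; b] by rewrite -e !inE eqxx orbT.
    move: xy N; rewrite !inE => xy N /orP[] /eqP ya /orP[] /eqP xa;
      by move: xy N; rewrite ya xa ?edge_irrefl ?eqxx ?orbT.
- case/orP => /eqP ->; first by rewrite eqxx; constructor 3.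
  by rewrite ab_neq; constructor 4.
- case/orP => /eqP ->; first by rewrite eqxx => /tri_swap; constructor 3; rewrite finset.setUC.
  by rewrite ab_neq => /tri_swap; constructor 4; rewrite finset.setUC.
Qed.

Let v_in1 : tri (phi a) v s1 v := triB _ _ _.
Let v_in : cell phi apex a b v := split_sub1 split_ab v_in1.
Let v_neq_a : v <> phi a.
Proof. by move=> e; move: va; rewrite e => /inq_irrefl. Qed.
Let v_neq_b : v <> phi b.
Proof. by move=> e; move: vb; rewrite e => /inq_irrefl. Qed.
Let ab_phi : phi a <> phi b.
Proof. by move/(layout_inj L) => e; move: ab; rewrite e edge_irrefl. Qed.
Let v_notin0 : ~ tri (phi a) (phi b) s0 v.
Proof. by move/(split_meet01 split_ab)/(_ v_in1)/v_neq_a. Qed.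
Let b_notin1 : ~ tri (phi a) v s1 (phi b).
Proof. by move/(split_meet01 split_ab (triB _ _ _))/esym/ab_phi. Qed.
Let a_notin2 : ~ tri (phi b) v s2 (phi a).
Proof. by move/(split_meet02 split_ab (triA _ _ _))/ab_phi. Qed.

(** New triangles lie in the old cell of [ab], so of the old vertices only [a] and [b] can be in
    them; an old cell containing [v] would meet that of [ab] outside [a] and [b]. *)
Lemma ext_avoid x y w : stack_rel a b x y ->
  cell ext_phi ext_apex x y (ext_phi w) -> w = x \/ w = y.
Proof.
suff H : stack_rel a b x y -> cell ext_phi ext_apex x y (ext_phi w) ->
    w \in [set x; y].
  by move=> /H{}H /H; rewrite !inE => /orP[] /eqP; [left | right].
move=> xy /(ext_cellP xy) [[x0 [y0 [-> -> e ne]]]|[->]|[->]|[->]];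
  case: w => [w|] /=; rewrite !inE //.
- by move=> c; case: (layout_avoid L e c) => ->; rewrite eqxx ?orbT.
- move=> c; case: (layout_meet L e ab c v_in) => // -[u].
  by rewrite !inE => /andP[_ /orP[] /eqP ->] => [/v_neq_a|/v_neq_b].
- by move/(split_sub0 split_ab)/(layout_avoid L ab) => [] ->; rewrite eqxx ?orbT.
- move=> c; have := split_sub1 split_ab c.
  by case/(layout_avoid L ab) => e; move: c; rewrite e ?eqxx // => /b_notin1.
- move=> c; have := split_sub2 split_ab c.
  by case/(layout_avoid L ab) => e; move: c; rewrite e ?eqxx // => /a_notin2.
Qed.

(** Two new triangles are separated by the splitting. An old cell meets a new triangle only at [a]
    or [b], and the triangle of [av] misses [b], that of [bv] misses [a]. *)
Lemma ext_meet x y x' y' z : stack_rel a b x y -> stack_rel a b x' y' ->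
  cell ext_phi ext_apex x y z -> cell ext_phi ext_apex x' y' z ->
  [set x; y] = [set x'; y'] \/
  exists2 u, u \in [set x; y] :&: [set x'; y'] & z = ext_phi u.
Proof.
have old x0 y0 : edge x0 y0 -> [set x0; y0] <> [set a; b] ->
    cell phi apex x0 y0 z -> cell phi apex a b z ->
    exists2 u, u \in [set x0; y0] & (u = a \/ u = b) /\ z = phi u.
  move=> e ne c c'; case: (layout_meet L e ab c c') => // -[u].
  rewrite !inE => /andP[u1 u2] zu; exists u; first by rewrite !inE.
  by split=> //; case/orP: u2 => /eqP; [left | right].
have som (x0 y0 u : G) : (Some u \in [set Some x0; Some y0]) = (u \in [set x0; y0]).
  by rewrite !inE.
have memI (u : option G) (A B : {set option G}) : u \in A -> u \in B -> u \in A :&: B.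
  by rewrite inE => -> ->.
have old_new x0 y0 (B : {set option G}) : edge x0 y0 -> [set x0; y0] <> [set a; b] ->
    cell phi apex x0 y0 z ->
    [\/ B = [set Some a; Some b] /\ tri (phi a) (phi b) s0 z,
        B = [set Some a; None] /\ tri (phi a) v s1 z |
        B = [set Some b; None] /\ tri (phi b) v s2 z] ->
    exists2 u, u \in [set Some x0; Some y0] :&: B & z = ext_phi u.
  move=> e ne c [] [-> c'].
  - case: (old _ _ e ne c (split_sub0 split_ab c')) => u ui [uab ->].
    exists (Some u) => //; apply: memI; rewrite ?som //.
    by case: uab => ->; rewrite !inE eqxx ?orbT.
  - case: (old _ _ e ne c (split_sub1 split_ab c')) => u ui [[] ue zu].
      by exists (Some u) => //; apply: memI; rewrite ?som // ue !inE eqxx.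
    by move: c'; rewrite zu ue => /b_notin1.
  - case: (old _ _ e ne c (split_sub2 split_ab c')) => u ui [[] ue zu].
      by move: c'; rewrite zu ue => /a_notin2.
    by exists (Some u) => //; apply: memI; rewrite ?som // ue !inE eqxx.
move=> xy xy' /(ext_cellP xy) + /(ext_cellP xy').
move=> [[x0 [y0 [-> -> e ne c]]]|[-> c]|[-> c]|[-> c]]
       [[x1 [y1 [-> -> e' ne' c']]]|[-> c']|[-> c']|[-> c']];
  try by left.
- case: (layout_meet L e e' c c') => [E|[u]].
    left; apply/setP => -[u|]; last by rewrite !inE.
    by move/setP: E => /(_ u); rewrite !inE.
  by rewrite inE => /andP[? ?] ?; right; exists (Some u); rewrite // memI ?som.
- by right; apply: old_new e ne c _; constructor 1.
- by right; apply: old_new e ne c _; constructor 2.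
- by right; apply: old_new e ne c _; constructor 3.
- by right; rewrite finset.setIC; apply: old_new e' ne' c' _; constructor 1.
- by right; exists (Some a); [rewrite !inE !eqxx | exact: (split_meet01 split_ab c c')].
- by right; exists (Some b); [rewrite !inE !eqxx ?orbT | exact: (split_meet02 split_ab c c')].
- by right; rewrite finset.setIC; apply: old_new e' ne' c' _; constructor 2.
- by right; exists (Some a); [rewrite !inE !eqxx | exact: (split_meet01 split_ab c' c)].
- by right; exists None; [rewrite !inE !eqxx ?orbT | exact: (split_meet12 split_ab c c')].
- by right; rewrite finset.setIC; apply: old_new e' ne' c' _; constructor 3.
- by right; exists (Some b); [rewrite !inE !eqxx ?orbT | exact: (split_meet02 split_ab c' c)].
- by right; exists None; [rewrite !inE !eqxx ?orbT | exact: (split_meet12 split_ab c' c)].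
Qed.

Let gC : symmetric g.
Proof. by move=> x y; rewrite /g /= g'C. Qed.

Let al_uniq x y Q : g x y -> inq Q (phi x) (phi y) -> al x Q.
Proof. by move=> /(layout_al L) [P xyP +] xyQ; rewrite (inq_uniq xyQ xyP). Qed.

Lemma ext_layout : layout (stack_rel a b) g' ext_phi ext_apex ext_al.
Proof.
have new x : g' None (Some x) -> x = a \/ x = b.
  by move/g'E => /= /orP[] /eqP; [left | right].
have newN : g' None None -> False by move/g'E.
split; [|exact: ext_apexC|exact: ext_avoid|exact: ext_meet| | |].
- have vN x : phi x <> v.
    move=> e; have := ext_avoid (x := Some a) (y := None) (w := Some x).
    rewrite /= eqxx e /cell /= eqxx => /(_ isT v_in1) [] // [xa].
    by apply: v_neq_a; rewrite -e xa.
  by move=> [x|] [y|] //= => [/(layout_inj L) ->|/vN|/esym/vN].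
- move=> [x|] [y|] //=.
  + exact: (layout_al L).
  + rewrite g'C => h; have xab := new _ h; move: h; case: xab => -> h.
      by exists Qa => //; case: (real_va h).
    by exists Qb => //; case: (real_vb h).
  + move=> h; have xab := new _ h; move: h; case: xab => -> h.
      by exists (opquad Qa); [apply/inqC | case: (real_va h)].
    by exists (opquad Qb); [apply/inqC | case: (real_vb h)].
- have loop Q x y : inq Q x y -> inq Q y x -> False.
    by move=> h h'; apply: (inq_irrefl (inq_trans h h')).
  (* An edge continuing [vx] beyond [x] would use the closed quadrant of [x] opposite to [v]. *)
  have out x Q : g' None (Some x) -> inq Q v (phi x) ->
      forall z, g' (Some x) (Some z) -> ~ inq Q (phi x) (phi z).
    move=> h; case: (new _ h) => -> q z /al_uniq r /r.
      by rewrite (inq_uniq q (P := opquad Qa)) ?(negPf ala) //; apply/inqC.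
    by rewrite (inq_uniq q (P := opquad Qb)) ?(negPf alb) //; apply/inqC.
  move=> Q [x|] [y|] [z|] //=.
  + exact: (layout_trans L).
  + move=> gxy; rewrite g'C => h q q'; case: (out y (opquad Q) h _ x).
    * exact/inqC.
    * by rewrite g'C.
    * exact/inqC.
  (* A path with middle vertex [v] has its ends among [a] and [b]; equal ends would give a monotone
     loop. *)
  + rewrite g'C => hx hz q q'; move: q q'.
    case: (new _ hx) => ->; case: (new _ hz) => -> q q'.
    * by exfalso; apply: loop q q'.
    * apply: Qab; rewrite -(inq_uniq q va); apply/(inq_uniq q'); exact/inqC.
    * have gab : g a b; last by rewrite g'C.
      apply: Qab; have -> : Qa = opquad Q; last by rewrite (inq_uniq q vb).
      by apply: (inq_uniq va); apply/inqC.
    * by exfalso; apply: loop q q'.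
  + by move=> h gyz q q'; case: (out _ _ h q _ gyz q').
  + by move=> _ _ q q'; exfalso; apply: loop q q'.
- move=> x y xy.
  have old x0 y0 : ~~ ((x0 == a) && (y0 == b) || (x0 == b) && (y0 == a)) ->
      ready g phi apex al x0 y0 -> ready' (Some x0) (Some y0).
    by rewrite /ready' /ready /monotone_pair /hinged_pair /= => /negPf ->.
  case: x y xy => [x|] [y|] //=.
  + move=> xy; case: (boolP ((x == a) && (y == b) || (x == b) && (y == a))).
      by case/orP => /andP[/eqP-> /eqP->]; [left | right].
    move=> N; case: (layout_ready L xy) => /old H; [left | right]; apply: H => //.
    by rewrite orbC andbC [X in _ || X]andbC.
  + by case/orP => /eqP ->.
  + by case/orP => /eqP ->; [case: ready_av | case: ready_bv]; auto.
Qed.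

End Extension.
End Layouts.

(** * Induction over 2-trees *)

Lemma opquad_slope Q : slope (opquad Q) = slope Q.
Proof. by case: Q => [[] []]. Qed.

Lemma opquad_neq Q : (opquad Q == Q) = false.
Proof. by case: Q => [[] []]. Qed.

Lemma slope_neq Q P : slope Q != slope P -> (Q == P) = false.
Proof. by move=> h; apply/eqP => e; rewrite e eqxx in h. Qed.

Section Stacking.
Variable F : realFieldType.

Lemma layout_al_dir (V : finType) (E g : rel V) (phi : V -> F * F) apex al x y Q :
  layout E g phi apex al -> g x y -> inq Q (phi x) (phi y) -> al x Q.
Proof. by move=> L /(layout_al L) [P xyP +] xyQ; rewrite (inq_uniq xyQ xyP). Qed.

Lemma layout_stack (G : sgraph) (a b : G) (g' : rel (option G))
    (phi : G -> F * F) apex al :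
  symmetric g' -> subrel g' (stack_rel a b) -> edge a b ->
  let g := relpre Some g' in
  layout (@edge G) g phi apex al -> ready g phi apex al a b ->
  exists phi' apex' al', layout (stack_rel a b) g' (phi' : _ -> F * F) apex' al'.
Proof.
move=> g'C g'E ab g L.
have ba : (b == a) = false by apply/negP => /eqP e; move: ab; rewrite e edge_irrefl.
case=> [[Q [gab qab alaQ albQ D0]]|].
  have [v [s0 [s1 [s2 [S [[sp D0' pv vq] [SQ Sv1 Sv2]]]]]]] := split_between D0 qab.
  have aQ : al a Q by apply: layout_al_dir L gab qab.
  have bQ : al b (opquad Q).
    have gba : g b a by rewrite /g /= g'C.
    by apply: layout_al_dir L gba _; apply/inqC.
  (* [Q] and [opquad Q] are the quadrants of [b] and [a] at [v]; [S] is the one in which both new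
     sides are hinged. *)
  pose alv R := R \in [:: Q; opquad Q; S].
  have NS : opquad S \notin [:: Q; opquad Q; S].
    by rewrite !inE opquad_neq !slope_neq // !opquad_slope.
  do 3 eexists; apply: (ext_layout (alv := alv) (Qa := Q) (Qb := opquad Q) g'C g'E L ab sp) => //.
  - by apply/inqC.
  - by rewrite opquadK.
  - by rewrite /alv !inE eqxx orbT.
  - by rewrite /alv !inE opquadK eqxx.
  - by left; exists Q; split=> //=; rewrite !eqxx.
  - right; right; exists S, Q; rewrite /= eqxx; do 2 split=> //.
      by rewrite eq_sym.
    by rewrite /alv !inE eqxx !orbT.
  - right; right; exists S, (opquad Q); rewrite /= ba; do 2 split=> //.
    + by apply/inqC.
    + by rewrite opquad_slope eq_sym.
    + by rewrite /alv !inE eqxx !orbT.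
    + by rewrite opquadK.
move=> [Q [P [[Qr Pqp PQ] [aQ aNQ bP bNP]]]].
have [v [s0 [[Qv Pv Qs0] [C1 C2]]]] := split_corner Qr Pqp PQ.
have QP : (Q == P) = false by rewrite slope_neq // eq_sym.
have QPo : (Q == opquad P) = false by rewrite slope_neq // opquad_slope eq_sym.
have PQ' : (P == opquad Q) = false by rewrite slope_neq // opquad_slope.
have QoP : (opquad Q == P) = false by rewrite eq_sym.
have QoPo : (opquad Q == opquad P) = false. by rewrite slope_neq // !opquad_slope eq_sym.
have apart : Q = opquad P -> g a b by move/eqP; rewrite QPo.
have hab s1 s2 alv : ready g' (ext_phi phi v) (ext_apex a b apex v s0 s1 s2)
    (ext_al al alv) (Some a) (Some b).
  by right; exists Q, P; rewrite /= !eqxx.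
have [vb|vb] := boolP (g' None (Some b)).
- have {C1 C2}[s1 [s2 [[sp Ps1 Qs2] [D1 D2]]]] := C2.
  (* These are the quadrants of [a] and [b] at [v]; the side [av], if not drawn, is hinged at [v] in
     [opquad P]. *)
  pose alv R := R \in [:: opquad Q; opquad P].
  have NQ : Q \notin [:: opquad Q; opquad P] by rewrite !inE QPo eq_sym opquad_neq.
  have NP : P \notin [:: opquad Q; opquad P] by rewrite !inE PQ' eq_sym opquad_neq.
  do 3 eexists; apply: (ext_layout (alv := alv) (Qa := Q) (Qb := P) g'C g'E L ab sp) => //.
  - by rewrite /alv !inE eqxx.
  - by rewrite /alv !inE eqxx orbT.
  - have [va|va] := boolP (g' None (Some a)).
      by left; left; exists Q; split; rewrite //= ?eqxx //= g'C.
    right; right; exists (opquad P), Q; rewrite /= eqxx; do 2 split=> //.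
    + by rewrite opquad_slope eq_sym.
    + by rewrite /alv !inE eqxx orbT.
    + by rewrite opquadK.
  - by left; left; exists P; split; rewrite //= ?ba // g'C.
have {C1 C2}[s1 [s2 [[sp Ps1 Qs2] [D1 D2]]]] := C1.
(* The undrawn side [bv] is hinged at [v] in [opquad Q], and [av], if not drawn, in [P]. *)
pose alv R := R \in [:: opquad Q; P].
have NQ : Q \notin [:: opquad Q; P] by rewrite !inE QP eq_sym opquad_neq.
have NP : opquad P \notin [:: opquad Q; P].
  by rewrite !inE eq_sym QoPo opquad_neq.
do 3 eexists; apply: (ext_layout (alv := alv) (Qa := Q) (Qb := P) g'C g'E L ab sp) => //.
- by rewrite /alv !inE eqxx.
- by move=> h; rewrite h in vb.
- have [va|va] := boolP (g' None (Some a)).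
    by left; left; exists Q; split; rewrite //= ?eqxx //= g'C.
  right; right; exists P, Q; rewrite /= eqxx; do 2 split=> //.
  + by rewrite eq_sym.
  + by rewrite /alv !inE eqxx orbT.
- right; right; exists (opquad Q), P; rewrite /= ba; do 2 split=> //.
  + by rewrite opquad_slope.
  + by rewrite /alv !inE eqxx.
  + by rewrite opquadK.
Qed.

Lemma layable_stack (G : sgraph) (a b : G) :
  edge a b -> layable F G -> layable F (stack a b).
Proof.
move=> ab LG g' g'C g'E.
have gE : subrel (relpre Some g') (@edge G) by move=> x y /g'E.
have [|phi [apex [al L]]] := LG (relpre Some g') _ gE; first by move=> x y; apply: g'C.
have [r|r] := layout_ready L ab; first by apply: layout_stack g'C g'E ab L r.
(* The state is oriented from [b] to [a]; stacking on [ba] gives the same graph. *)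
have ba : edge b a by rewrite edge_sym.
have g'E' : subrel g' (stack_rel b a).
  by move=> x y /g'E; case: x y => [x|] [y|] //=; rewrite orbC.
have [phi' [apex' [al' L']]] := layout_stack g'C g'E' ba L r.
exists phi', apex', al'; apply: (layout_pull (h := id) _ _ _ L') => //.
by move=> [x|] [y|] //=; rewrite orbC.
Qed.

Lemma layable_iso (G H : sgraph) (f : G -> H) :
  bijective f -> {mono f : x y / edge x y} -> layable F G -> layable F H.
Proof.
move=> [h fK hK] fE LG g gC gE.
have gC' : symmetric (fun x y => g (f x) (f y)) by move=> x y; apply: gC.
have gE' : subrel (fun x y => g (f x) (f y)) (@edge G) by move=> x y /gE; rewrite fE.
have [phi [apex [al L]]] := LG _ gC' gE'.
exists (phi \o h), (fun x y => apex (h x) (h y)), (al \o h).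
apply: layout_pull _ _ _ L; first exact: can_inj hK.
- by move=> x y; rewrite -fE !hK.
- by move=> x y; rewrite !hK.
Qed.

(** The induction on layouts starts from one edge; the triangle is then a stacking on it. *)
Definition single_edge_rel : rel bool := fun x y => x != y.

Lemma single_edge_sym : symmetric single_edge_rel.
Proof. by move=> x y; rewrite /single_edge_rel eq_sym. Qed.

Lemma single_edge_irrefl : irreflexive single_edge_rel.
Proof. by move=> x; rewrite /single_edge_rel eqxx. Qed.

Definition single_edge : sgraph := SGraph single_edge_sym single_edge_irrefl.

Lemma layable_single_edge : layable F single_edge.
Proof.
move=> g gC gE.
exists (fun x : bool => if x then (1, 1) else (0, 0)).
(* This apex serves both states: the triangle is nondegenerate, and at (0, 0) the apex lies in a
   quadrant whose slope is opposite to that of the edge. *)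
exists (fun x y : bool => (1, -1)).
exists (fun x : bool => if x then pred1 (true, true)
  else pred2 (false, false) (false, true)).
have dir : inq (false, false) (0, 0) ((1, 1) : F * F).
  by rewrite /inq /= !expr0 !mul1r !subr0 ltr01.
split=> //=.
- by move=> [] [] // [] e; move: (oner_neq0 F); rewrite -?e ?eqxx // e eqxx.
- by move=> [] [] [] // _ _; auto.
- move=> x y x' y' z xy xy' _ _; left; apply/setP => u; rewrite !inE.
  by case: x y x' y' u xy xy' => [] [] [] [] [].
- move=> [] [] /[dup] /gE // _ _.
    by exists (true, true) => //; apply/inqC.
  by exists (false, false).
- move=> Q x y z /gE + /gE; case: x y z => [] [] [] //= _ _ q q';
    by case: (inq_irrefl (inq_trans q q')).
- have H : ready g (fun x : bool => if x then (1, 1) else (0, 0))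
    (fun x y : bool => (1, -1) : F * F) (fun x : bool => if x then pred1 (true, true)
     else pred2 (false, false) (false, true)) false true.
    have [h|h] := boolP (g false true).
      left; exists (false, false); split=> //=.
      by rewrite /det /= lt_eqF //; lra.
    right; exists (false, true), (true, true); do 2 split=> //=.
      by rewrite /inq /= expr0 expr1; lra.
    by rewrite /inq /= expr1; lra.
  by move=> [] [] // _; [right | left].
Qed.

Lemma layable_triangle : layable F triangle.
Proof.
pose f (x : stack (G := single_edge) false true) : triangle :=
  if x is Some x then (if x then inord 1 else inord 0) else inord 2.
have fE : {mono f : x y / edge x y}.
  by move=> [[]|] [[]|]; rewrite /= /triangle_rel /f -val_eqE /= !inordK.
apply: (layable_iso (f := f) _ fE).
  apply: inj_card_bij; last by rewrite card_option card_bool card_ord.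
  by move=> [[]|] [[]|] // /(congr1 val); rewrite /= !inordK.
by apply: layable_stack => //; apply: layable_single_edge.
Qed.

Lemma layable_two_tree (G : sgraph) : two_tree G -> layable F G.
Proof.
elim=> {G} [|G a b _ LG ab|G H f fb fE _ LG].
- exact: layable_triangle.
- exact: layable_stack ab LG.
- exact: layable_iso fb fE LG.
Qed.

End Stacking.

(** * Quadrants by angle, segments, and the drawing given by a layout *)

Section Drawings.
Variable R : realType.

Definition in_sector (i : nat) (x y : R) : Prop :=
  exists r theta : R,
    [/\ 0 <= r, i%:R * (pi / 2) <= theta <= i.+1%:R * (pi / 2),
        x = r * cos theta & y = r * sin theta].

(** A quarter turn shifts the angle by [pi / 2]; iterating it reduces every quadrant to the
    first. *)
Lemma in_sectorS i x y : in_sector i.+1 x y <-> in_sector i y (- x).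
Proof.
have E (k : nat) : k.+1%:R * (pi / 2) = k%:R * (pi / 2) + pi / 2 :> R.
  by rewrite -natr1 mulrDl mul1r.
split=> -[r [t [r0 /andP[t1 t2] xE yE]]].
  exists r, (t - pi / 2); rewrite cosBpihalf sinBpihalf mulrN -xE -yE; split=> //.
  by rewrite !E in t1 t2 *; apply/andP; split; lra.
exists r, (t + pi / 2); rewrite cosDpihalf sinDpihalf mulrN -xE -yE opprK; split=> //.
by rewrite !E in t1 t2 *; apply/andP; split; lra.
Qed.

Lemma in_sector0 x y : in_sector 0 x y <-> 0 <= x /\ 0 <= y.
Proof.
have pi0 := pi_gt0 R.
split=> [[r [t [r0]]]|[x0 y0]].
  rewrite mul0r mul1r => /andP[t0 t1] -> ->; rewrite !mulr_ge0 //.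
    by apply: sin_ge0_pi; rewrite t0 /=; lra.
  by apply: cos_ge0_pihalf; rewrite t1 andbT; lra.
pose r := Num.sqrt (x ^+ 2 + y ^+ 2).
have s0 : 0 <= x ^+ 2 + y ^+ 2 by rewrite addr_ge0 ?sqr_ge0.
have r2 : r ^+ 2 = x ^+ 2 + y ^+ 2 by rewrite sqr_sqrtr.
have r0 : 0 <= r by apply: sqrtr_ge0.
have [rz|rn] := eqVneq r 0.
  move/eqP: r2; rewrite rz expr0n /= eq_sym paddr_eq0 ?sqr_ge0 // !sqrf_eq0.
  move=> /andP[/eqP-> /eqP->]; exists 0, 0; rewrite !mul0r mul1r lexx; split=> //=.
  by lra.
have rp : 0 < r by rewrite lt_neqAle eq_sym rn.
have xr1 : 0 <= x / r by rewrite divr_ge0.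
have e1 : 1 - (x / r) ^+ 2 = (y / r) ^+ 2.
  by rewrite !expr_div_n r2; field; rewrite -r2 sqrf_eq0.
have xr2 : x / r <= 1.
  rewrite -(@ler_pXn2r _ 2) ?nnegrE // expr1n -subr_ge0 e1; exact: sqr_ge0.
have xr : - 1 <= x / r <= 1 by rewrite xr2 andbT; lra.
exists r, (acos (x / r)).
have cE : cos (acos (x / r)) = x / r by rewrite acosK // in_itv.
rewrite cE sin_acos // e1 sqrtr_sqr ger0_norm ?divr_ge0 //.
split=> //; [|by field|by field].
(* An angle beyond [pi / 2] would have a negative cosine, whereas [x / r] is nonnegative. *)
rewrite mul0r mul1r acos_ge0 //= leNgt; apply/negP => t.
have : 0 < sin (acos (x / r) - pi / 2).
  by apply: sin_gt0_pi; have := acos_lepi xr; move=> ?; apply/andP; split; lra.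
by rewrite sinBpihalf cE oppr_gt0 ltNge xr1.
Qed.

Definition quad_of (i : 'I_4) : quad :=
  ((i == 1 :> nat) || (i == 2 :> nat), (i == 2 :> nat) || (i == 3 :> nat))%N.

Lemma quadrantE (i : 'I_4) (x y : R * R) :
  quadrant i x y <-> 0 <= (-1) ^+ (quad_of i).1 * (y.1 - x.1) /\
                     0 <= (-1) ^+ (quad_of i).2 * (y.2 - x.2).
Proof.
transitivity (in_sector i (y.1 - x.1) (y.2 - x.2)).
  split=> [[r [t [r0 t1 ->]]]|[r [t [r0 t1 e1 e2]]]]; exists r, t.
    by rewrite /= !(addrC x.1) !(addrC x.2) !addrK.
  by split=> //; apply: pair_ext; rewrite /= -?e1 -?e2; ring.
case: i => -[|[|[|[|//]]]] ?; rewrite /quad_of /= ?in_sectorS in_sector0;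
  by rewrite ?expr0 ?expr1; split=> -[? ?]; split; lra.
Qed.

(** Membership in some open quadrant excludes zero coordinates, so the weak inequalities become
    strict. *)
Lemma quadrant_inq i Q (x y : R * R) :
  quadrant i x y -> inq Q x y -> inq (quad_of i) x y.
Proof.
move/quadrantE; case: (quad_of i) => s1 s2 /= [a1 a2] [b1 b2].
have key (s s' : bool) (d : R) :
    0 <= (-1) ^+ s * d -> 0 < (-1) ^+ s' * d -> 0 < (-1) ^+ s * d.
  by case: s s' => [] []; rewrite /= ?expr0 ?expr1; lra.
by split; [apply: key a1 b1 | apply: key a2 b2].
Qed.

Lemma quad_of_surj Q : exists i, quad_of i = Q.
Proof.
case: Q => [[] []]; [exists (inord 2)|exists (inord 1)|exists (inord 3)|exists (inord 0)];
  by rewrite /quad_of !inordK.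
Qed.

Definition seg_curve (x y : R * R) (t : R) : R * R :=
  ((1 - t) * x.1 + t * y.1, (1 - t) * x.2 + t * y.2).

Lemma seg_curve0 x y : seg_curve x y 0 = x.
Proof. by apply: pair_ext => /=; ring. Qed.

Lemma seg_curve1 x y : seg_curve x y 1 = y.
Proof. by apply: pair_ext => /=; ring. Qed.

Lemma seg_curveC x y t : seg_curve y x t = seg_curve x y (1 - t).
Proof. by apply: pair_ext => /=; ring. Qed.

Lemma seg_curve_tri x y r t : 0 <= t <= 1 -> tri x y r (seg_curve x y t).
Proof.
move=> /andP[t0 t1]; exists (t, 0); rewrite /= addr0 lexx; split=> //.
by apply: pair_ext => /=; ring.
Qed.

Lemma seg_curve_continuous x y : curve (seg_curve x y).
Proof.
have lin (a b : R) : continuous (fun t : R => (1 - t) * a + t * b)%R.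
  move=> t; apply: cvgD.
    by apply: cvgM; [apply: cvgB; [exact: cvg_cst | exact: cvg_id] | exact: cvg_cst].
  by apply: cvgM; [exact: cvg_id | exact: cvg_cst].
apply: continuous_subspaceT => t.
exact: (cvg_pair (lin x.1 y.1 t) (lin x.2 y.2 t)).
Qed.

Lemma inq_neq Q (x y : R * R) : inq Q x y -> y.1 - x.1 != 0.
Proof.
by move=> [q _]; apply/eqP => e; move: q; rewrite e mulr0 ltxx.
Qed.

Lemma seg_curve_inj Q x y : inq Q x y -> injective (seg_curve x y).
Proof.
move=> /inq_neq d s t /(congr1 fst) /eqP; rewrite -subr_eq0 /= => e.
apply/eqP; move: e; rewrite -[s == t]subr_eq0 (_ : _ - _ = (s - t) * (y.1 - x.1)); last by ring.
by rewrite mulf_eq0 (negPf d) orbF.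
Qed.

Lemma seg_curve_monotone Q x y : inq Q x y -> delta2_monotone (seg_curve x y).
Proof.
have [i <-] := quad_of_surj Q => -[q1 q2]; exists i => a b _ ab _.
apply/quadrantE => /=.
have E (c x1 y1 : R) : c * ((1 - b) * x1 + b * y1 - ((1 - a) * x1 + a * y1)) =
  (b - a) * (c * (y1 - x1)) by ring.
by rewrite !E; split; apply: mulr_ge0; rewrite ?subr_ge0 // ltW.
Qed.

Section FromLayout.
Variables (G : sgraph) (phi : G -> R * R) (apex : G -> G -> R * R).
Variable al : G -> quad -> bool.
Hypothesis L : layout (@edge G) (@edge G) phi apex al.
Let c (u w : G) := seg_curve (phi u) (phi w).

Lemma layout_plane : plane_drawing phi c.
Proof.
have dir u w : edge u w -> exists Q, inq Q (phi u) (phi w).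
  by move=> /(layout_al L) [Q uw _]; exists Q.
have c_cell u w t : t \in `[0, 1] -> cell phi apex u w (c u w t).
  by rewrite in_itv /= => t01; apply: seg_curve_tri.
split.
- exact: (layout_inj L).
- by move=> u w _; apply: seg_curve_continuous.
- by move=> u w _; apply: seg_curve0.
- by move=> u w _; apply: seg_curve1.
- by move=> u w _ t _; apply: seg_curveC.
- by move=> u w /dir [Q q] s t _ _ /(seg_curve_inj q).
- move=> u w v uw t t01 e; apply: (layout_avoid L uw).
  by rewrite -e; apply: c_cell.
- move=> u w u' w' uw uw' ne s t s01 t01 e.
  have h := c_cell u' w' t t01; rewrite -e in h.
  by case: (layout_meet L uw uw' (c_cell u w s s01) h) => // E; rewrite E eqxx in ne.
Qed.

Lemma path_curve0 u w p : path_curve c u w p 0 = phi u.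
Proof.
case: p => [|v p] /=; first exact: seg_curve0.
by rewrite /concat invr_ge0 ler0n mulr0 /c seg_curve0.
Qed.

Definition monotone_in (i : 'I_4) (f : R -> R * R) : Prop :=
  forall a b : R, 0 <= a -> a <= b -> b <= 1 -> quadrant i (f a) (f b).

Lemma concat_monotone i f1 f2 : f1 1 = f2 0 ->
  monotone_in i (concat f1 f2) -> monotone_in i f1 /\ monotone_in i f2.
Proof.
move=> e h.
have e1 t : t <= 1 -> concat f1 f2 (t / 2) = f1 t.
  by move=> t1; rewrite /concat ifT; [congr f1; field | lra].
have e2 t : 0 <= t -> concat f1 f2 ((t + 1) / 2) = f2 t.
  (* At [t = 0] the argument is 1/2, where [concat] still follows [f1]; the hypothesis [e] matches
     the two values. *)
  rewrite le_eqVlt => /orP[/eqP <-|t0].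
    by rewrite add0r e1.
  rewrite /concat ifF; first by congr f2; field.
  by apply/negbTE; rewrite -ltNge; lra.
split=> a b a0 ab b1.
  by rewrite -(e1 a) -?(e1 b) //; [apply: h; lra | lra].
by rewrite -(e2 a) -?(e2 b) //; [apply: h; lra | lra].
Qed.

(** By induction the tail of the path can be replaced by a single edge in the same quadrant, and
    [layout_trans] then absorbs the first edge. *)
Lemma path_curve_inq i u w p : path (@edge G) u (w :: p) ->
  monotone_in i (path_curve c u w p) ->
  inq (quad_of i) (phi u) (phi (last w p)) /\ edge u (last w p).
Proof.
have one x y : edge x y -> monotone_in i (c x y) -> inq (quad_of i) (phi x) (phi y).
  move=> /(layout_al L) [Q q _] /(_ 0 1); rewrite /c seg_curve0 seg_curve1 => h.
  by apply: quadrant_inq q; apply: h.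
elim: p u w => [|v p IH] u w.
  by rewrite /= andbT => uw h; split=> //; apply: one.
move=> /andP[uw wp] /= /concat_monotone [|h1 h2].
  by rewrite path_curve0; apply: seg_curve1.
have [q' e'] := IH w v wp h2; have q := one _ _ uw h1.
by split; [apply: inq_trans q q' | exact: (layout_trans L uw e' q q')].
Qed.

Lemma layout_embedding : plane_delta2_obstacle_embedding phi c.
Proof.
split; first exact: layout_plane.
  by move=> u w /(layout_al L) [Q q _]; apply: seg_curve_monotone q.
by move=> u w p up _ [i h]; have [] := path_curve_inq up h.
Qed.

End FromLayout.

Lemma partial_two_tree_layout (G : sgraph) : partial_two_tree G ->
  exists phi apex al, layout (@edge G) (@edge G) (phi : _ -> R * R) apex al.
Proof.
move=> [H HT [f f_inj f_hom]].
(* The image of [G] in the 2-tree is the graph to draw there; the layout is then pulled back along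
   [f]. *)
pose g x y := [exists u, exists w, [&& f u == x, f w == y & edge u w]].
have gP u w : g (f u) (f w) = edge u w.
  apply/existsP/idP => [[u' /existsP[w' /and3P[/eqP/f_inj-> /eqP/f_inj->]]]|uw] //.
  by exists u; apply/existsP; exists w; rewrite !eqxx.
have gC : symmetric g.
  by move=> x y; apply/existsP/existsP => -[u /existsP[w /and3P[? ? ?]]];
     exists w; apply/existsP; exists u; apply/and3P; split; rewrite 1?edge_sym.
have gE : subrel g (@edge H).
  by move=> x y /existsP[u /existsP[w /and3P[/eqP<- /eqP<- /f_hom]]].
have [phi [apex [al L]]] := layable_two_tree R HT gC gE.
by do 3 eexists; apply: (layout_pull (h := f)) L.
Qed.

End Drawings.

Theorem theorem11 (R : realType) (G : sgraph) (hG : partial_two_tree G) :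
  exists (phi : G -> (R * R)%type) (c : G -> G -> R -> (R * R)%type),
    plane_delta2_obstacle_embedding phi c /\ straight_line phi c.
Proof.
have [phi [apex [al L]]] := partial_two_tree_layout R hG.
exists phi, (fun u w => seg_curve (phi u) (phi w)).
by split; first exact: layout_embedding L.
Qed.
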